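(* For every integer $n\geq 3$, $c_3(n)=c_4(n)$, where $c_3(n)=|\mathcal C_n^{+-+}|$ and $c_4(n)=|\mathcal C_n^{-+-}|$; that is, the signatures $+-+$ and $-+-$ are c-Wilf-equivalent.
   Context: $\mathcal S_n$ is the set of permutations of $[n]$ in one-line notation $\pi=\pi_1\cdots\pi_n$; $\mathcal C_n$ is the set of cyclic permutations (single $n$-cycle) in $\mathcal S_n$. For $\sigma=\sigma^0\cdots\sigma^{k-1}\in\{+,-\}^k$, $\mathcal S^\sigma_n$ is the set of $\pi\in\mathcal S_n$ for which there exist $0=e_0\le e_1\le\cdots\le e_k=n$ with each segment $\pi_{e_i+1}\cdots\pi_{e_{i+1}}$ increasing if $\sigma^i=+$ and decreasing if $\sigma^i=-$; $\mathcal C_n^\sigma=\mathcal C_n\cap\mathcal S_n^\sigma$. Two signatures are c-Wilf-equivalent if for every $n$ they have equally many cyclic permutations of length $n$ in their classes. *)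

(* Defs.v *)
From mathcomp Require Import all_boot all_order all_fingroup.
Set Implicit Arguments. Unset Strict Implicit. Unset Printing Implicit Defensive.

(* A permutation s : 'S_n represents the one-line word pi_1 ... pi_n with
   pi_(i+1) = s i (positions and values shifted down by 1: [n] ~ {0..n-1}). *)

(* Signature letters: true = '+', false = '-'. *)
Definition signature := seq bool.

Definition seg_mono n (s : 'S_n) (sg : bool) (a b : nat) : bool :=
  [forall i : 'I_n, forall j : 'I_n, ((a <= i) && (i < j) && (j < b)) ==>
    (if sg then s i < s j else s j < s i)].

(* S_n^sigma : there exist 0 = e_0 <= e_1 <= ... <= e_k = n (each e_i in
   {0..n}) with each segment pi_{e_i+1} ... pi_{e_{i+1}} monotone according to
   sigma^i (positions e_i .. e_{i+1}-1 in 0-based indexing). *)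
Definition in_sig_class (sigma : signature) n (s : 'S_n) : bool :=
  [exists e : {ffun 'I_(size sigma).+1 -> 'I_n.+1},
    [&& e ord0 == 0 :> nat, e ord_max == n :> nat &
        [forall i : 'I_(size sigma),
           (e (inord i) <= e (inord i.+1)) &&
           seg_mono s (nth true sigma i) (e (inord i)) (e (inord i.+1))]]].

Definition cyclic_perm n (s : 'S_n) : bool := #|porbits s| == 1.

Definition Csig (sigma : signature) n : {set 'S_n} :=
  [set s : 'S_n | cyclic_perm s && in_sig_class sigma s].

(* Main.v *)
Require Import Defs.
From mathcomp Require Import all_boot all_order all_fingroup all_algebra zify.
Set Implicit Arguments. Unset Strict Implicit. Unset Printing Implicit Defensive.
Import GRing.Theory.

(* Idea. Write a cyclic permutation as [rot1 ^ r], where [rot1] is [x |-> x + 1] on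
   Z/n, and label the positions of its three monotone segments by 0, 1, 2; for
   n >= 3 each permutation of the class has exactly four labellings. Pulling the
   labels back along [r] gives a word on Z/n, and [r] must sort the rotations of
   this word for the signed lexicographic order. A primitive word admits exactly
   one such [r]; a word with a nonzero period admits none, except that the square
   of a primitive word with an odd number of negative letters admits two. So only
   the last kind of word depends on the signature, and it remains to see that
   primitive ternary words of length m > 1 with an odd number of letters 1 and
   those with an odd number of letters 0 and 2 are equinumerous. If m is even
   they are the same words; if m is odd, swapping 0 and 1 along a coset of the
   periods of the set of positions of the letters 0 and 1 changes the parity of
   the number of letters 1 and preserves primitivity. *)

(* The letters whose segment is decreasing, for the signature [+-+] if [b = false]
   and [-+-] if [b = true]. *)
Definition neg (b : bool) (l : 'I_3) : bool := (l == 1 :> nat) (+) b.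

(** * Permutations and the strict orders they induce *)

Section StrictTotalOrder.
Variables (n : nat) (L : rel 'I_n).
Hypotheses (Lirr : irreflexive L) (Ltr : transitive L)
  (Ltot : forall x y, x != y -> L x y || L y x).

(** Each point goes to the number of points below it; irreflexivity keeps this rank under [n],
    transitivity and totality make it faithful. *)
Lemma exists_ranking : exists r : 'S_n, forall x y, (r x < r y) = L x y.
Proof.
have rkP x : #|[set y | L y x]| < n.
  rewrite -[X in _ < X](card_ord n) -cardsT; apply: proper_card.
  by apply/properP; split; [apply: subsetT | exists x; rewrite ?inE ?Lirr].
pose rk x := Ordinal (rkP x).
have rk_lt x y : L x y -> rk x < rk y.
  move=> Lxy; apply: proper_card; apply/properP; split.
    by apply/subsetP=> z; rewrite !inE => /Ltr; apply.
  by exists x; rewrite !inE ?Lirr.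
have rk_inj : injective rk.
  move=> x y /(congr1 val) /= e; apply/eqP/negPn/negP => /Ltot /orP[] /rk_lt /=;
  by rewrite e ltnn.
exists (perm rk_inj) => x y; rewrite !permE.
apply/idP/idP=> [lt_xy|]; last exact: rk_lt.
have /Ltot/orP[//|/rk_lt] : x != y by apply: contraTneq lt_xy => ->; rewrite ltnn.
by move/ltnW; rewrite leqNgt lt_xy.
Qed.

End StrictTotalOrder.

Lemma perm_lt_inj n (r r' : 'S_n) :
  (forall x y, (r x < r y) = (r' x < r' y)) -> r = r'.
Proof.
have rkE (s : 'S_n) x : #|[set y | s y < s x]| = s x :> nat.
  rewrite -(card_imset _ (@perm_inj _ s)).
  have -> : [set s y | y in [set y | s y < s x]] = [set z : 'I_n | z < s x].
    apply/setP=> z; apply/imsetP/idP=> [[y]|]; rewrite !inE; first by move=> ? ->.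
    by move=> ltz; exists (s^-1 z)%g; rewrite ?inE permKV.
  rewrite -sum1dep_card (big_ord_narrow (ltnW (ltn_ord (s x)))) /=.
  by rewrite sum_nat_const card_ord muln1.
move=> h; apply/permP=> x; apply: val_inj => /=; rewrite -(rkE r) -(rkE r').
by apply: eq_card => y; rewrite !inE h.
Qed.

(** * Words on Z/n and the permutations that sort their rotations *)

Section Words.
Variable p : nat.
Local Notation Z := 'I_p.+3.
Local Notation word := {ffun Z -> 'I_3}.
Implicit Types (a : word) (r : 'S_p.+3) (x y t : Z) (b : bool).

(** Signed lexicographic sorting of the rotations in local form: a tie is passed on to the next
    positions, cyclically. *)
Definition good b a r := [forall x, forall y, (r x < r y) ==>
  (a x < a y) || (a x == a y) && (if neg b (a x) then r (y + 1)%R < r (x + 1)%R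
                                  else r (x + 1)%R < r (y + 1)%R)].

Definition stab a := [set t | [forall x, a (x + t)%R == a x]].

Lemma stabP a t : reflect (forall x, a (x + t)%R = a x) (t \in stab a).
Proof. by rewrite inE; apply: 'forall_eqP. Qed.

(** For [x != y] exactly one of [r x < r y] and [r y < r x] holds, so the implication in [good],
    applied to both orders of the pair, becomes an equation. *)
Lemma goodP b a r : reflect (forall x y, x != y -> (r x < r y) =
  (a x < a y) || (a x == a y) && ((r (x + 1)%R < r (y + 1)%R) (+) neg b (a x)))
  (good b a r).
Proof.
have flip x y : x != y -> (r y < r x) = ~~ (r x < r y).
  move=> nxy; rewrite -leqNgt [in RHS]leq_eqVlt.
  by case: eqP => // /val_inj /perm_inj e; rewrite e eqxx in nxy.
have flip1 x y : x != y -> (r (y + 1)%R < r (x + 1)%R) = ~~ (r (x + 1)%R < r (y + 1)%R).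
  by move=> nxy; apply: flip; rewrite (inj_eq (addIr _)).
have addbE (A N : bool) : A (+) N = if N then ~~ A else A by case: A N => [] [].
apply: (iffP forallP) => h x; last first.
  apply/forallP=> y; apply/implyP => lt_xy.
  have nxy : x != y by apply: contraTneq lt_xy => ->; rewrite ltnn.
  by rewrite (flip1 x y) // -addbE -h.
move=> y nxy; have hh u v : r u < r v -> _ := fun w => implyP (forallP (h u) v) w.
rewrite addbE -(flip1 x y) //; apply/idP/idP=> [/hh //|].
apply: contraLR; rewrite -flip // => /hh.
case: (eqVneq (a x) (a y)) => [->|ne]; last by case: ltngtP.
rewrite ltnn /=; case: neg; rewrite -leqNgt; exact: ltnW.
Qed.

Fixpoint par b a j x : bool :=
  if j is j'.+1 then neg b (a x) (+) par b a j' (x + 1)%R else false.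

Lemma addrS x j : (x + 1 + j%:R = x + j.+1%:R)%R.
Proof. by rewrite -addrA -natr1 [(1 + _)%R]addrC. Qed.

Lemma par_add b a i j x : par b a (i + j) x = par b a i x (+) par b a j (x + i%:R)%R.
Proof. by elim: i x => [|i IH] x; rewrite ?addr0 // addSn /= IH addrS addbA. Qed.

Lemma par_stab b a j t x : t \in stab a -> par b a j (x + t)%R = par b a j x.
Proof.
move=> /stabP ht; elim: j x => //= j IH x; by rewrite ht addrAC IH.
Qed.

Section Good.
Variables (b : bool) (a : word) (r : 'S_p.+3).
Hypothesis gd : good b a r.

(** Letters a period apart always tie, so each step to the right reverses the comparison exactly
    when the letter read is negative. *)
Lemma good_stab_shift t x j : t \in stab a -> t != 0%R ->
  (r x < r (x + t)%R) = (r (x + j%:R)%R < r (x + j%:R + t)%R) (+) par b a j x.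
Proof.
move=> /stabP ht t0; elim: j x => [|j IH] x; first by rewrite addr0 addbF.
have nx : x != (x + t)%R by rewrite -[X in X == _]addr0 (inj_eq (addrI _)) eq_sym.
rewrite (goodP _ _ _ gd) // ht ltnn eqxx /= [(x + t + 1)%R]addrAC (IH (x + 1)%R) addrS.
by rewrite -addbA [par _ _ _ _ (+) _]addbC.
Qed.

(* If the parity were even, [r x < r (x + j) < r (x + 2 j) < ...] would go on
   forever along a finite cycle. *)
Lemma good_par_odd j : (j%:R)%R \in stab a -> (j%:R : Z)%R != 0%R -> par b a j 0%R.
Proof.
move=> ht t0; set t : Z := (j%:R)%R in ht t0 *; apply/negPn/negP => /negbTE pj.
have step k : (r (t *+ k)%R < r (t *+ k.+1)%R) = (r 0%R < r t).
  elim: k => [|k <-]; first by rewrite mulr0n mulr1n.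
  rewrite [RHS](_ : _ = (r (t *+ k)%R < r (t *+ k + t)%R)); last by rewrite -mulrSr.
  rewrite (good_stab_shift _ j ht t0) -/t.
  have -> : par b a j (t *+ k)%R = false.
    elim: k => [|k IH]; first by rewrite mulr0n.
    by rewrite mulrSr par_stab.
  by rewrite addbF -!mulrSr.
have t_n : (t *+ p.+3 = 0)%R.
  by apply: val_inj; rewrite -[(t *+ _)%R]mulr_natr Zp_nat /= modnn muln0 mod0n.
case e: (r 0%R < r t).
  have inc k : r 0%R < r (t *+ k.+1)%R.
    by elim: k => [|k IH]; [rewrite mulr1n|apply: ltn_trans IH _; rewrite step].
  by have := inc p.+2; rewrite t_n ltnn.
have stepN k : r (t *+ k.+1)%R < r (t *+ k)%R.
  rewrite ltn_neqAle leqNgt step e andbT; apply/negP => /eqP/val_inj/perm_inj.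
  by rewrite mulrSr -[RHS]addr0 => /addrI/eqP; rewrite (negbTE t0).
have dec k : r (t *+ k.+1)%R < r 0%R.
  by elim: k => [|k IH]; [have := stepN 0; rewrite mulr0n|apply: ltn_trans IH].
by have := dec p.+2; rewrite t_n ltnn.
Qed.

Lemma good_stab_double t : t \in stab a -> t != 0%R -> (t + t = 0)%R.
Proof.
move=> ht t0; apply/eqP/negPn/negP => tt0.
have et : (((t : nat)%:R : Z) = t)%R by rewrite natr_Zp.
have ht2 : (t + t)%R \in stab a by apply/stabP => x; rewrite addrA !(stabP _ _ ht).
have e2 : (((t + t : nat)%N)%:R : Z)%R = (t + t)%R by rewrite natrD et.
(* Here [j] is the unreduced natural number [t + t]. Its parity is a sum of two equal parities over
   [t] letters, hence even, which [good_par_odd] forbids for a nonzero period. *)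
have := good_par_odd (j := t + t); rewrite e2 par_add et par_stab // addbb.
by move=> /(_ ht2 tt0).
Qed.

End Good.

(** A disagreement at a pair forces equal letters there and passes to the next pair; going once
    around the circle, all letters agree. *)
Lemma good_uniq_stab b a r r' x y : good b a r -> good b a r' -> x != y ->
  (r x < r y) != (r' x < r' y) -> (y - x)%R \in stab a.
Proof.
move=> /goodP g /goodP g' nxy0 ne.
have H k : (x + k%:R != y + k%:R)%R /\
    (r (x + k%:R)%R < r (y + k%:R)%R) != (r' (x + k%:R)%R < r' (y + k%:R)%R)
    /\ (0 < k -> a (x + k.-1%:R)%R = a (y + k.-1%:R)%R).
  elim: k => [|k [nk [IH _]]]; first by rewrite !addr0.
  have nS : (x + k.+1%:R != y + k.+1%:R)%R by rewrite (inj_eq (addIr _)).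
  split=> //; move: IH; rewrite g // g' // -!addrA !natr1.
  case: (eqVneq (a (x + k%:R)%R) (a (y + k%:R)%R)) => [->|nea]; last by rewrite !orbF eqxx.
  by rewrite ltnn /= => h; split=> //; apply: contraNneq h => ->.
apply/stabP => u.
pose d := (u - x)%R; have [_ [_ /(_ isT)]] := H (nat_of_ord d).+1.
rewrite -pred_Sn natr_Zp /d [(x + _)%R]addrC subrK => ->.
by congr (a _); rewrite addrCA.
Qed.

(** * Construction of a sorting permutation *)

Section Existence.
Variables (b : bool) (a : word) (V0 : Z -> bool).
(** [V0] orders positions whose rotations coincide: it flips under nonzero periods and changes along
    the word exactly at negative letters. For a primitive word the condition is void. *)
Hypothesis V0P : forall t x, t \in stab a -> t != 0%R ->
  V0 (x + t)%R = ~~ V0 x /\ V0 x = V0 (x + 1)%R (+) neg b (a x).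

(* Signed lexicographic comparison of the first [N] letters read from [x] and
   from [y], with ties broken by [V0]. *)
Fixpoint lexlt N x y : bool :=
  if N is N'.+1 then (a x < a y) || (a x == a y) &&
    (if neg b (a x) then lexlt N' (y + 1)%R (x + 1)%R
     else lexlt N' (x + 1)%R (y + 1)%R)
  else ~~ V0 x && V0 y.

Fixpoint separated N x y : bool :=
  if N is N'.+1 then (a x != a y) || separated N' (x + 1)%R (y + 1)%R
  else (y - x)%R \in stab a.

Lemma lexltS N x y : lexlt N.+1 x y = (a x < a y) || (a x == a y) &&
  (if neg b (a x) then lexlt N (y + 1)%R (x + 1)%R else lexlt N (x + 1)%R (y + 1)%R).
Proof. by []. Qed.

Lemma lexlt_irr N : irreflexive (lexlt N).
Proof.
by elim: N => [|N IH] x /=; [case: V0 | rewrite ltnn eqxx /= IH if_same].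
Qed.

Lemma lexlt_trans N : transitive (lexlt N).
Proof.
elim: N => [|N IH] y x z /=; first by case: V0; case: V0.
case: (eqVneq (a x) (a y)) => [->|nxy]; last first.
  rewrite /= orbF => lt_xy /orP[lt_yz|/andP[/eqP <- _]]; last by rewrite lt_xy.
  by rewrite (ltn_trans lt_xy lt_yz).
rewrite ltnn /=; case: (eqVneq (a y) (a z)) => [->|nyz]; last first.
  by rewrite /= orbF => _ ->.
by rewrite ltnn /=; case: neg => h1 h2; [apply: IH h2 h1|apply: IH h1 h2].
Qed.

Lemma neq_next x y : x != y -> (x + 1 != y + 1)%R.
Proof. by rewrite (inj_eq (addIr _)). Qed.

Lemma lexltN N x y : separated N x y -> x != y -> lexlt N y x = ~~ lexlt N x y.
Proof.
elim: N x y => [|N IH] x y /= => [st nxy|].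
  have t0 : (y - x != 0)%R by rewrite subr_eq0 eq_sym.
  by have [] := V0P x st t0; rewrite addrC subrK => -> _; case: V0.
case: (eqVneq (a x) (a y)) => [e|ne] /=.
  move=> sN nxy; rewrite e ltnn /= (IH (x + 1)%R) ?neq_next //.
  by case: neg; rewrite ?negbK.
by move=> _ _; rewrite !orbF -leqNgt [LHS]ltn_neqAle val_eqE eq_sym ne.
Qed.

Lemma separated_sym N x y : separated N x y = separated N y x.
Proof.
elim: N x y => [|N IH] x y /=; last by rewrite eq_sym IH.
have sub u v : (v - u)%R \in stab a -> (u - v)%R \in stab a.
  move=> /stabP st; apply/stabP => z.
  by rewrite -[LHS]st -[(v - u)%R]opprB addrK.
by apply/idP/idP; apply: sub.
Qed.

(** An extra letter can matter only when the rotations coincide, and there the second half of [V0P]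
    absorbs its sign. *)
Lemma lexlt_stable N x y : separated N x y -> x != y -> lexlt N x y = lexlt N.+1 x y.
Proof.
elim: N x y => [|N IH] x y => [st nxy|].
  have t0 : (y - x != 0)%R by rewrite subr_eq0 eq_sym.
  have e : (y = x + (y - x))%R by rewrite addrC subrK.
  have ay : a y = a x by rewrite e; apply: (stabP _ _ st).
  have [] := V0P x st t0; have [] := V0P (x + 1)%R st t0.
  rewrite addrAC -e => v3 _ v1 v2; rewrite /= ay v1 v3 v2 ltnn eqxx /=.
  by case: neg; case: (V0 _).
move=> sN nxy; rewrite lexltS [RHS]lexltS; move: sN; rewrite /separated -/separated.
case: (eqVneq (a x) (a y)) => [e|//] sN; congr (_ || _).
case: neg; rewrite IH ?neq_next //; last by rewrite eq_sym.
by rewrite separated_sym.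
Qed.

(** Agreement on [p.+3] consecutive letters covers the whole circle, so the difference is a
    period. *)
Lemma separatedP x y : separated p.+3 x y.
Proof.
have sepN N u v : ~~ separated N u v ->
    ((v - u)%R \notin stab a) /\ forall k, k < N -> a (u + k%:R)%R = a (v + k%:R)%R.
  elim: N u v => [|N IH] u v //=; rewrite negb_or negbK => /andP[/eqP e /IH[st ih]].
  split=> [|[|k]]; first by move: st; rewrite opprD addrACA subrr addr0.
    by rewrite !addr0.
  by move=> /ih; rewrite !addrS.
apply/negPn/negP => /sepN[/negP st h]; apply: st; apply/stabP => u.
pose d := (u - x)%R; have := h _ (ltn_ord d).
rewrite natr_Zp /d [(x + _)%R]addrC subrK => ->.
by congr (a _); rewrite addrCA.
Qed.

Lemma exists_good : exists r, good b a r.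
Proof.
have [r rE] : exists r : 'S_p.+3, forall x y, (r x < r y) = lexlt p.+3 x y.
  apply: exists_ranking; [exact: lexlt_irr|exact: lexlt_trans|] => x y nxy.
  by rewrite (lexltN (separatedP x y) nxy) orbN.
exists r; apply/forallP => x; apply/forallP => y; apply/implyP => lt_xy.
have nxy : x != y by apply: contraTneq lt_xy => ->; rewrite ltnn.
(* Depth [p.+4] exposes the first letters and leaves depth [p.+3] at the next positions, as [good]
   requires. *)
by rewrite !rE; move: lt_xy; rewrite rE lexlt_stable ?separatedP.
Qed.

End Existence.
End Words.

(** * Number of sorting permutations of each word *)

Section Count.
Variable p : nat.
Local Notation Z := 'I_p.+3.
Local Notation word := {ffun Z -> 'I_3}.
Implicit Types (a : word) (r : 'S_p.+3) (x y t h : Z) (b : bool).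

Lemma stab0 a : (0%R : Z) \in stab a.
Proof. by apply/stabP => x; rewrite addr0. Qed.

Lemma card_good_primitive b a : stab a = [set 0%R] -> #|[set r | good b a r]| = 1.
Proof.
move=> st; have [r gr] : exists r, good b a r.
  by apply: (@exists_good _ _ _ (fun _ => false)) => t x; rewrite st inE => ->.
rewrite (_ : [set r | _] = [set r]) ?cards1 //.
apply/setP => r'; rewrite !inE; apply/idP/eqP => [gr'|-> //].
apply: perm_lt_inj => x y; case: (eqVneq x y) => [->|nxy]; first by rewrite !ltnn.
case: (eqVneq (r' x < r' y) (r x < r y)) => // /(good_uniq_stab gr' gr nxy).
by rewrite st inE subr_eq0 eq_sym (negbTE nxy).
Qed.

Definition halfturn h := (h != 0%R) && (h + h == 0)%R.

Lemma halfturn_val h : halfturn h -> h + h = p.+3.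
Proof.
case/andP => h0 /eqP/(congr1 val) /= e.
have {}h0 : 0 < h by rewrite lt0n; apply: contraNneq h0 => h0; apply/eqP/val_inj.
have hlt := ltn_ord h; case: (ltnP (h + h) p.+3) => [lt|le].
  by rewrite modn_small // in e; lia.
by rewrite -(subnK le) modnDr modn_small in e; lia.
Qed.

Lemma halfturn_uniq h h' : halfturn h -> halfturn h' -> h = h'.
Proof. by move=> /halfturn_val e /halfturn_val e'; apply: val_inj => /=; lia. Qed.

(** Such a word is the square of a primitive word of length [h]. *)
Definition doubled a h := halfturn h && (stab a == [set 0%R; h]).

Definition odd_doubled b : {set word} :=
  [set a | [exists h, doubled a h && par b a h 0%R]].

Lemma val_lt_neq r x y : x != y -> (r y < r x) = ~~ (r x < r y).
Proof.
move=> nxy; rewrite -leqNgt [LHS]ltn_neqAle val_eqE (inj_eq perm_inj) eq_sym.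
by rewrite nxy.
Qed.

(** The tie-break at [x] is the parity of the negative letters between 0 and [x]. It is well defined
    modulo [p.+3] because a full turn is two equal half turns, and it flips over a half turn because
    [par b a h 0] is odd. *)
Lemma exists_good_doubled b a h : doubled a h -> par b a h 0%R -> exists r, good b a r.
Proof.
case/andP=> hh /eqP st ph; have hs : h \in stab a by rewrite st !inE eqxx orbT.
have hv := halfturn_val hh.
have per i : par b a (i + p.+3) 0%R = par b a i 0%R.
  rewrite addnC -hv -addnA !par_add !add0r natr_Zp -[X in par _ _ _ X]add0r.
  have -> : (h + h = 0)%R by case/andP: hh => _ /eqP.
  rewrite addr0 -[X in _ (+) (par _ _ _ X (+) _)]add0r par_stab // addbA addbb.
  by [].
have par_mod i : par b a (i %% p.+3) 0%R = par b a i 0%R.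
  rewrite [in RHS](divn_eq i p.+3); elim: (i %/ p.+3) => [|q ->] //.
  by rewrite mulSn -[in RHS]addnA [in RHS]addnC per.
apply: (@exists_good _ _ _ (fun x => par b a x 0%R)) => t x.
rewrite st !inE => /orP[/eqP->|/eqP-> _]; first by rewrite eqxx.
split; rewrite /= par_mod.
  by rewrite addnC par_add ph /= add0r natr_Zp -[X in par _ _ _ X]add0r par_stab.
by rewrite modn_small // par_add /= add0r natr_Zp addbF -addbA addbb addbF.
Qed.

(** Two sorting permutations can differ only on pairs at distance [h], and [good_stab_shift] ties
    all these pairs to the pair [0], [h]; so there are at most two. Precomposing with the half turn
    yields the other one. *)
Lemma card_good_odd_doubled b a : a \in odd_doubled b -> #|[set r | good b a r]| = 2.
Proof.
rewrite inE => /existsP[h /andP[dh ph]]; have [r gr] := exists_good_doubled dh ph.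
case/andP: dh => hh /eqP st; have hs : h \in stab a by rewrite st !inE eqxx orbT.
case/andP: (hh) => h0 /eqP h2.
pose f (s : 'S_p.+3) := s 0%R < s h.
have f_inj : {in [set r | good b a r] &, injective f}.
  move=> s s'; rewrite !inE => gs gs' ef.
  apply: perm_lt_inj => x y; case: (eqVneq x y) => [->|nxy]; first by rewrite !ltnn.
  case: (eqVneq (s x < s y) (s' x < s' y)) => // ne; have := good_uniq_stab gs gs' nxy ne.
  rewrite st !inE subr_eq0 eq_sym (negbTE nxy) /= subr_eq addrC => /eqP ey.
  move: ef ne; rewrite /f -[X in _ < s X]add0r -[X in _ < s' X]add0r.
  rewrite (good_stab_shift gs 0%R x hs h0) (good_stab_shift gs' 0%R x hs h0) !add0r.
  rewrite !natr_Zp -ey.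
  by move=> /addIb ->; rewrite eqxx.
pose s := perm (inj_comp (@perm_inj _ r) (addIr h)).
have gs : good b a s.
  apply/forallP=> x; apply/forallP=> y; apply/implyP; rewrite !permE /=.
  move/goodP: gr => gr lt_xy.
  have nxy : (x + h != y + h)%R.
    by apply: contraTneq lt_xy => /addIr ->; rewrite ltnn.
  have nxy1 : (x + h + 1 != y + h + 1)%R by rewrite (inj_eq (addIr _)).
  move: lt_xy; rewrite gr // !(stabP _ _ hs) ![(_ + 1 + h)%R]addrAC.
  rewrite (val_lt_neq r nxy1).
  by case: neg; rewrite ?addbT ?addbF.
have fs : f s = ~~ f r.
  by rewrite /f !permE /= add0r h2 (val_lt_neq r (x := 0%R)) // eq_sym.
rewrite -(card_in_imset f_inj) -card_bool; apply: eq_card => c; rewrite [RHS]inE.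
apply/imsetP; case: (eqVneq c (f r)) => [->|ne]; first by exists r; rewrite ?inE.
by exists s; rewrite ?inE // fs; move: ne; case: c; case: (f r).
Qed.

(** By [good_stab_double] and [good_par_odd], a nonzero period of a sortable word is the half turn,
    with odd parity. *)
Lemma card_good_eq0 b a : stab a != [set 0%R] -> a \notin odd_doubled b ->
  #|[set r | good b a r]| = 0.
Proof.
move=> st nod; apply/eqP; rewrite cards_eq0; apply/eqP/setP => r; rewrite !inE.
apply/negbTE/negP => gr.
have [t ts t0] : exists2 t, t \in stab a & t != 0%R.
  have : ~~ (stab a \subset [set 0%R]).
    by apply: contraNN st => st; rewrite eqEsubset st sub1set stab0.
  by case/subsetPn => t ts; rewrite inE => t0; exists t.
have ht : halfturn t by rewrite /halfturn t0 (good_stab_double gr ts t0) eqxx.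
move/negP: nod; apply; rewrite inE; apply/existsP; exists t; apply/andP; split.
  rewrite /doubled ht eqEsubset /=; apply/andP; split; apply/subsetP => u.
    move=> us; rewrite !inE; case: (eqVneq u 0%R) => //= u0; apply/eqP.
    by apply: halfturn_uniq ht; rewrite /halfturn u0 (good_stab_double gr us u0) eqxx.
  by rewrite in_set2 => /orP[] /eqP->; rewrite ?stab0.
by apply: (good_par_odd gr); rewrite natr_Zp.
Qed.

Lemma sum_card_good b : \sum_(a : word) #|[set r | good b a r]| =
  #|[set a : word | stab a == [set 0%R]]| + #|odd_doubled b| * 2.
Proof.
rewrite -sum1dep_card -sum_nat_const [X in _ = X + _]big_mkcond.
rewrite [X in _ = _ + X]big_mkcond -big_split /=.
apply: eq_bigr => a _; case: eqP => [st|/eqP st].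
  rewrite card_good_primitive //; case: ifP => //.
  rewrite inE => /existsP[h /andP[/andP[/andP[h0 _] /eqP]]].
  by rewrite st => /setP/(_ h); rewrite !inE eqxx orbT (negbTE h0).
by case: ifP => [/card_good_odd_doubled|/negbT/card_good_eq0] ->.
Qed.

End Count.

(** * Squares of primitive words and a parity-changing involution *)

Section ParityInvolution.
Variable p : nat.
Local Notation Z := 'I_p.+3.
Local Notation word := {ffun Z -> 'I_3}.
Implicit Types (a : word) (x y t h : Z) (b : bool) (S : {set Z}).

Lemma parE b a j x : par b a j x = odd (\sum_(k < j) neg b (a (x + (k : nat)%:R)%R)).
Proof.
elim: j x => [|j IH] x; first by rewrite big_ord0.
rewrite big_ord_recl oddD /= IH addr0; congr (_ (+) odd _); first by case: neg.
by apply: eq_bigr => k _; rewrite addrS.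
Qed.

Lemma sum_halfturn (f : Z -> nat) h : halfturn h -> (forall x, f (x + h)%R = f x) ->
  \sum_x f x = (\sum_(k < h) f ((k : nat)%:R)%R) * 2.
Proof.
move=> hh fh; have hv := halfturn_val hh.
have -> : \sum_x f x = \sum_(0 <= k < h + h) f (k%:R)%R.
  by rewrite hv big_mkord; apply: eq_bigr => x _; rewrite natr_Zp.
rewrite (@big_cat_nat _ _ _ h) ?leq_addr //= -{2}[h : nat]add0n big_addn addnK.
rewrite muln2 -addnn !big_mkord; congr (_ + _); apply: eq_bigr => k _.
by rewrite natrD natr_Zp fh.
Qed.

Lemma even_halfturn_invariant S h : halfturn h -> (forall x, ((x + h)%R \in S) = (x \in S)) ->
  ~~ odd #|S|.
Proof.
move=> hh Sh; rewrite -sum1_card big_mkcond /= (sum_halfturn hh) ?oddM ?andbF // => x.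
by rewrite Sh.
Qed.

Definition weight b a := \sum_x neg b (a x).

(** The two halves of the word are equal, so its weight is twice that of a half. *)
Lemma par_halfturn b a h : doubled a h ->
  par b a h 0%R = odd (weight b a)./2 /\ ~~ odd (weight b a).
Proof.
case/andP=> hh /eqP st; have hs : h \in stab a by rewrite st !inE eqxx orbT.
rewrite /weight (sum_halfturn hh) => [|x]; last by rewrite (stabP _ _ hs).
rewrite muln2 doubleK odd_double parE; split=> //; congr odd.
by apply: eq_bigr => k _; rewrite add0r.
Qed.

Lemma weightD a : weight false a + weight true a = p.+3.
Proof.
rewrite -big_split /= -[RHS]card_ord -sum1_card; apply: eq_bigr => x _.
by rewrite /neg; case: (_ == _).
Qed.

Definition swap01 (l : 'I_3) : 'I_3 := if l < 2 then inord (1 - l) else l.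

Lemma swap01_lt2 (l : 'I_3) : (swap01 l < 2) = (l < 2).
Proof. by rewrite /swap01; case: ifP => // h; rewrite inordK; lia. Qed.

Lemma swap01K : involutive swap01.
Proof.
move=> l; rewrite {1}/swap01 swap01_lt2; case: ifP => h; last by rewrite /swap01 h.
by apply: val_inj; rewrite /= /swap01 h !inordK; lia.
Qed.

Lemma neg_swap01 (l : 'I_3) : l < 2 -> neg false (swap01 l) = ~~ neg false l.
Proof. by move=> h; rewrite /neg /swap01 h !addbF inordK; lia. Qed.

Definition shape a := [set x | a x < 2].
Definition periods S := [set t : Z | [forall x, ((x + t)%R \in S) == (x \in S)]].

Lemma periodsP S t : reflect (forall x, ((x + t)%R \in S) = (x \in S)) (t \in periods S).
Proof. by rewrite inE; apply: 'forall_eqP. Qed.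

Lemma periods_add S t u : t \in periods S -> ((u + t)%R \in periods S) = (u \in periods S).
Proof.
move=> /periodsP ht; apply/periodsP/periodsP => hu x; last by rewrite addrA ht hu.
by have := hu x; rewrite addrA ht.
Qed.

Lemma card_periods S : #|periods S| %| p.+3.
Proof.
have gS : group_set (periods S).
  apply/group_setP; split=> [|x y hx hy]; first by apply/periodsP => x; rewrite addr0.
  by rewrite -[(x * y)%g]/(x + y)%R periods_add.
by have := cardSg (subsetT (Group gS)); rewrite cardsT card_ord.
Qed.

(** The default is reached only for empty [S], which [flip_weight] rules out for the shapes it
    treats. *)
Definition flip_base S : Z := odflt 0%R [pick x in S].
(** The coset of the group [periods S] through the base point; it lies inside [S] as soon as the
    base point does. *)
Definition flip_set S := [set x | (x - flip_base S)%R \in periods S].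

Lemma mem_flip_set S x : (x \in flip_set S) = ((x - flip_base S)%R \in periods S).
Proof. by rewrite [LHS]in_set. Qed.

(* The flipped set is invariant under all periods of a word of shape [S], so
   primitivity is preserved. *)
Definition flip S a : word := [ffun x => if x \in flip_set S then swap01 (a x) else a x].

Lemma flipK S : involutive (flip S).
Proof.
by move=> a; apply/ffunP => x; rewrite !ffunE; case: (x \in _); rewrite ?swap01K.
Qed.

Lemma shape_flip S a : shape (flip S a) = shape a.
Proof.
by apply/setP => x; rewrite !inE ffunE; case: ifP; rewrite ?swap01_lt2.
Qed.

Lemma stab_sub_periods a : stab a \subset periods (shape a).
Proof. by apply/subsetP => t /stabP ht; apply/periodsP => x; rewrite !inE ht. Qed.

Lemma flip_set_period S t x : t \in periods S -> ((x + t)%R \in flip_set S) = (x \in flip_set S).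
Proof. by move=> ht; rewrite !mem_flip_set addrAC (periods_add _ ht). Qed.

(** A period of a word is one of its shape, so it preserves the flipped coset and survives the flip.
    The converse follows since [flip] is an involution keeping the shape. *)
Lemma stab_flip a : stab (flip (shape a) a) = stab a.
Proof.
have sub c : stab c \subset stab (flip (shape c) c).
  apply/subsetP => t ts; have tp := subsetP (stab_sub_periods c) _ ts.
  by apply/stabP => x; rewrite !ffunE flip_set_period // (stabP _ _ ts).
apply/eqP; rewrite eqEsubset sub andbT.
by have := sub (flip (shape a) a); rewrite shape_flip flipK.
Qed.

Lemma card_flip_set S : #|flip_set S| = #|periods S|.
Proof.
rewrite -(card_imset (periods S) (addIr (flip_base S))); apply: eq_card => x.
apply/idP/imsetP => [|[y hy ->]]; last by rewrite mem_flip_set addrK.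
by rewrite mem_flip_set => hx; exists (x - flip_base S)%R; rewrite ?subrK.
Qed.

(** Modulo 4 the two weights add up to [#|periods S|]: a flipped position counts once, the others
    twice an even number. This cardinal is an even divisor of [h + h] with [h] odd, so it is 2
    modulo 4. *)
Lemma flip_weight a h : doubled a h -> odd h ->
  odd (weight false (flip (shape a) a))./2 = ~~ odd (weight false a)./2.
Proof.
move=> dh oh; set a' := flip _ _; set S := shape a.
have dh' : doubled a' h by rewrite /doubled stab_flip.
have [_ ev] := par_halfturn false dh; have [_ ev'] := par_halfturn false dh'.
case/andP: dh => hh /eqP st; have hs : h \in stab a by rewrite st !inE eqxx orbT.
have hp : h \in periods S := subsetP (stab_sub_periods a) _ hs.
have hv := halfturn_val hh.
have S_n0 : flip_base S \in S.
  (* With an empty shape all letters are 2 and 1 is a period, so [h] is 1, contradicting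
     [h + h = p.+3]. *)
  rewrite /flip_base; case: pickP => //= S0; exfalso.
  have : (1%R : Z) \in stab a.
    apply/stabP => x; have a2 y : a y = 2 :> nat.
      by have := S0 y; rewrite inE /= => /negbT; have := ltn_ord (a y); lia.
    by apply: val_inj; rewrite /= !a2.
  rewrite st !inE oner_eq0 /= => /eqP/(congr1 val).
  by rewrite [LHS]/= modn_small // => e; move: hv; rewrite -[nat_of_ord h]e.
have flipS x : x \in flip_set S -> a x < 2.
  rewrite mem_flip_set => /periodsP/(_ (flip_base S)).
  by rewrite addrC subrK S_n0 inE.
pose E := [set x | (x \notin flip_set S) && neg false (a x)].
have wE : weight false a + weight false a' = #|flip_set S| + #|E| * 2.
  have cardE (A : {set Z}) : #|A| = \sum_x (x \in A).
    by rewrite -sum1_card big_mkcond; apply: eq_bigr => x _; case: (x \in A).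
  rewrite muln2 -addnn !cardE /weight -!big_split /=.
  apply: eq_bigr => x _; rewrite /a' ffunE [x \in E]inE.
  case: ifP => [/flipS hx|_] /=; first by rewrite neg_swap01 //; case: neg.
  by case: neg.
have evE : ~~ odd #|E|.
  apply: (even_halfturn_invariant hh) => x.
  by rewrite [LHS]in_set [RHS]in_set flip_set_period // (stabP _ _ hs).
have evS : ~~ odd #|periods S|.
  by apply: (even_halfturn_invariant hh) => x; rewrite periods_add.
have /dvdnP[q eq] := card_periods S; rewrite card_flip_set in wE.
have [c ec] : exists c, #|periods S| = c.*2 by exists #|periods S|./2; lia.
have : odd (q * c) by rewrite ec in eq; have -> : q * c = h by lia.
by rewrite oddM => /andP[_ oc]; rewrite ec in wE; lia.
Qed.

Lemma card_odd_doubled : #|odd_doubled p false| = #|odd_doubled p true|.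
Proof.
case: (boolP [exists h : Z, halfturn h]) => [/existsP[h hh]|/existsPn nh]; last first.
  have e0 b : odd_doubled p b = set0.
    apply/setP => a; rewrite !inE; apply/negbTE/existsPn => h.
    by rewrite /doubled (negbTE (nh h)).
  by rewrite !e0.
have hv := halfturn_val hh.
have odE b a : (a \in odd_doubled p b) = (doubled a h) && odd (weight b a)./2.
  rewrite inE; apply/existsP/andP => [[h' /andP[dh']]|[dh ow]].
    have -> : h = h' by apply: halfturn_uniq => //; case/andP: dh'.
    by rewrite (par_halfturn b dh').1.
  by exists h; rewrite dh (par_halfturn b dh).1.
(* The two weights are even and add up to [h + h]: their halves have equal parity for even [h],
   opposite parity for odd [h], where the flip is needed. *)
case oh: (odd h); last first.
  apply: eq_card => a; rewrite !odE; case dh: (doubled a h) => //=.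
  have := weightD a; have := (par_halfturn false dh).2; have := (par_halfturn true dh).2.
  by lia.
pose F a := flip (shape a) a.
have FK : involutive F by move=> a; rewrite /F shape_flip flipK.
rewrite -(card_imset _ (inv_inj FK)); apply: eq_card => a.
have -> : (a \in F @: odd_doubled p false) = (F a \in odd_doubled p false).
  by rewrite -{1}(FK a) mem_imset //; apply: inv_inj.
rewrite !odE /doubled stab_flip -/(doubled a h); case dh: (doubled a h) => //=.
rewrite (flip_weight dh oh).
have := weightD a; have := (par_halfturn false dh).2; have := (par_halfturn true dh).2.
by lia.
Qed.

End ParityInvolution.

(** * Labellings of the monotone segments *)

Section Adapted.
Variable m : nat.
Implicit Types (i j : 'I_m.+1) (s : 'S_m.+1) (w : {ffun 'I_m.+1 -> 'I_3}) (b : bool).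

(** Cut points are encoded by the segment number of each position, in a form that matches [good]. *)
Definition adapted b w s := [forall i : 'I_m.+1, forall j : 'I_m.+1, (i < j) ==>
  (w i < w j) || (w i == w j) && (if neg b (w i) then s j < s i else s i < s j)].

Lemma adaptedP b w s : reflect (forall i j, i < j ->
    w i < w j \/ w i = w j /\ (if neg b (w i) then s j < s i else s i < s j))
  (adapted b w s).
Proof.
apply: (iffP forallP) => h i => [j lt|].
  have /implyP/(_ lt)/orP[|/andP[/eqP]] := forallP (h i) j; by [left|right].
by apply/forallP => j; apply/implyP => /h[->//|[-> ->]]; rewrite eqxx orbT.
Qed.

Lemma adapted_mono b w s i j : adapted b w s -> i <= j -> w i <= w j.
Proof.
move=> /adaptedP h; rewrite leq_eqVlt => /orP[/eqP/val_inj -> //|/h[/ltnW //|[-> //]]].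
Qed.

Lemma in_sig_classE b s :
  in_sig_class [:: ~~ b; b; ~~ b] s = [exists w, adapted b w s].
Proof.
have sgE (k : 'I_3) : nth true [:: ~~ b; b; ~~ b] k = ~~ neg b k.
  by case: k => [[|[|[|k]]]] //= lt3; rewrite /neg /= ?negbK.
apply/existsP/existsP => [[e /and3P[/eqP e0 /eqP e3 /forallP h]]|[w wP]].
  rewrite /= in e e0 e3 h.
  have seg (k : 'I_3) (i j : 'I_m.+1) : e (inord k) <= i -> i < j -> j < e (inord k.+1) ->
      if neg b k then s j < s i else s i < s j.
    move=> h1 h2 h3; have /andP[_ /forallP/(_ i)/forallP/(_ j)] := h k.
    by rewrite h1 h2 h3 sgE if_neg.
  have e_le (k : 'I_3) : e (inord k) <= e (inord k.+1) by case/andP: (h k).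
  have e01 := e_le ord0; have e12 := e_le (inord 1); have e23 := e_le (inord 2).
  rewrite !inordK // in e12 e23; rewrite /= in e01.
  pose e1 : nat := e (inord 1); pose e2 : nat := e (inord 2).
  have ie0 : e (inord 0) = 0 :> nat 
    by rewrite -[RHS]e0; congr (nat_of_ord (e _)); apply: val_inj; rewrite /= inordK.
  have ie3 : e (inord 3) = m.+1 :> nat 
    by rewrite -[RHS]e3; congr (nat_of_ord (e _)); apply: val_inj; rewrite /= inordK.
  pose w := [ffun i : 'I_m.+1 => inord ((e1 <= i) + (e2 <= i)) : 'I_3].
  have wE i : w i = (e1 <= i) + (e2 <= i) :> nat.
    by rewrite ffunE inordK //; case: (e1 <= i); case: (e2 <= i).
  have wb i : e (inord (w i)) <= i < e (inord (w i).+1).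
    rewrite wE; have := ltn_ord i.
    by case: (leqP e1 i); case: (leqP e2 i) => h2 h1; rewrite /= ?ie0 ?ie3 -/e1 -/e2; lia.
  exists w; apply/adaptedP => i j lt_ij; case: (ltnP (w i) (w j)) => [|le]; first by left.
  right; have ew : w i = w j.
    by apply: val_inj => /=; move: le; rewrite !wE -/e1 -/e2; lia.
  split=> //; apply: seg => //; first by case/andP: (wb i).
  by rewrite ew; case/andP: (wb j).
(* Cut [k] comes just after the last position labelled below [k]; the empty maximum 0 is right when
   there is none. *)
pose ex (k : nat) := \max_(i : 'I_m.+1 | w i < k) i.+1.
have exlt k (i : 'I_m.+1) : (i < ex k) = (w i < k).
  apply/idP/idP => [|lt]; last by rewrite /ex (bigD1 i) //= leq_maxl.
  apply: contraTT; rewrite -!leqNgt => le; apply/bigmax_leqP => j lt.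
  rewrite ltnNge; apply: contraL lt => /(adapted_mono wP) le'.
  by rewrite -leqNgt (leq_trans le).
have ex_le k : ex k < m.+2 by rewrite ltnS; apply/bigmax_leqP => i _.
exists [ffun k : 'I_4 => Ordinal (ex_le k)]; rewrite !ffunE /=.
apply/and3P; split.
- by rewrite /ex big_pred0.
- by rewrite eqn_leq -ltnS ex_le /=; have := exlt 3 ord_max; rewrite /= ltn_ord.
apply/forallP => k; rewrite !ffunE /= !inordK ?ltnS ?(ltnW (ltn_ord k)) //; last exact: (ltn_ord k).
apply/andP; split.
  by apply/bigmax_leqP => i lt; rewrite exlt; apply: leqW.
apply/forallP => i; apply/forallP => j; apply/implyP; rewrite exlt leqNgt exlt -leqNgt.
case/andP=> /andP[h1 h2] h3; have le := adapted_mono wP (ltnW h2).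
have [e1 e2] : w i = k /\ w j = k.
  split; apply/val_inj/eqP; rewrite eqn_leq -ltnS ?h1 ?h3 ?(leq_trans h1 le) //.
  by rewrite (leq_ltn_trans le h3).
have [|[_]] := adaptedP _ _ _ wP i j h2; first by rewrite e1 e2 ltnn.
by rewrite sgE if_neg e1.
Qed.

(** Reversing the values exchanges increasing and decreasing segments, which reduces [-+-] to
    [+-+]. *)
Lemma adapted_rev w s : adapted true w s = adapted false w (s * perm rev_ord_inj)%g.
Proof.
have revE (x y : 'I_m.+1) : (perm rev_ord_inj x < perm rev_ord_inj y) = (y < x).
  by rewrite !permE /=; have := ltn_ord x; have := ltn_ord y; lia.
apply: eq_forallb => i; apply: eq_forallb => j; rewrite !permM !revE.
by rewrite {1 2}/neg addbT addbF; case: (_ == 1).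
Qed.

Section Descents.
Variable s : 'S_m.+1.
Let f k : nat := s (inord k).
Let descent k := (k < m) && (f k.+1 < f k).

Lemma ascent k : k < m -> ~~ descent k -> f k < f k.+1.
Proof.
rewrite /descent => lt; rewrite lt /= -leqNgt leq_eqVlt.
case/orP=> // /eqP/val_inj/perm_inj/(congr1 val); rewrite /= !inordK //; lia.
Qed.

Lemma exists_descent : s != 1%g -> exists k, descent k.
Proof.
move=> s1; suff : [exists k : 'I_m, descent k] by case/existsP => k; exists k.
apply: contraNT s1 => /existsPn nd.
have inc k : k < m -> f k < f k.+1.
  by move=> lt; apply: ascent => //; apply: nd (Ordinal lt).
have {inc} inc (i j : nat) : i < j -> j <= m -> f i < f j.
  elim: j => // j IH; rewrite ltnS leq_eqVlt => /orP[/eqP->|lt] le; first exact: inc.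
  by apply: ltn_trans (inc j le); apply: IH (ltnW le).
apply/eqP/perm_lt_inj => x y; rewrite !perm1.
have fE z : s z = f z :> nat by rewrite /f inord_val.
case: (ltngtP x y) => [lt|lt|/val_inj->]; last by rewrite ltnn.
  by rewrite !fE inc ?leq_ord.
by apply/negbTE; rewrite -leqNgt ltnW // !fE inc ?leq_ord.
Qed.

(* A nonidentity permutation with an adapted labelling has its descents on an
   interval [P, Q[; the positions [P] and [Q] can each be labelled in two ways
   and all other labels are forced. *)
Lemma card_adapted w0 : s != 1%g -> adapted false w0 s ->
  #|[set w | adapted false w s]| = 4.
Proof.
move=> s1 aw0; have exd := exists_descent s1.
have dle k : descent k -> k <= m by case/andP=> /ltnW.
(* [P] is the first descent and [L] the last, so the end [Q] of the interval is [L.+1]. *)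
case: (ex_minnP exd) => P dP minP; case: (ex_maxnP exd dle) => L dL maxL.
have PL : P <= L := minP _ dL.
have Lm : L < m by case/andP: dL.
have fE (z : 'I_m.+1) : s z = f z :> nat by rewrite /f inord_val.
have inc0 (i j : nat) : i < j -> j <= P -> f i < f j.
  elim: j => // j IH; rewrite ltnS => le_ij le.
  have fj : f j < f j.+1.
    by apply: ascent; [lia|apply/negP => /minP; lia].
  by move: le_ij; rewrite leq_eqVlt => /orP[/eqP->//|/IH]; lia.
have inc2 (i j : nat) : L < i -> i < j -> j <= m -> f i < f j.
  move=> Li; elim: j => // j IH; rewrite ltnS => le_ij le.
  have fj : f j < f j.+1 by apply: ascent => //; apply/negP => /maxL; lia.
  by move: le_ij; rewrite leq_eqVlt => /orP[/eqP->//|/IH]; lia.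
have adE w : adapted false w s -> forall i j : nat, i < j -> j <= m ->
    w (inord i) < w (inord j) \/ w (inord i) = w (inord j) :> nat /\
    (if w (inord i) == 1 :> nat then f j < f i else f i < f j).
  move=> /adaptedP h i j lt le; have /h[] : (inord i : 'I_m.+1) < (inord j : 'I_m.+1).
    by rewrite !inordK; lia.
    by left.
  by case=> -> /=; rewrite /neg addbF; right.
(* Label 0 at [P.+1] would force an ascent at [P], and label 2 at [L] an ascent at [L]. *)
have lab w : adapted false w s -> 0 < w (inord P.+1) /\ w (inord L) <= 1.
  move=> /adE h; case/andP: dP => P1 P2; case/andP: dL => L1 L2; split.
    by have [|[]] := h P P.+1 (ltnSn P) P1; [lia | case: eqP; lia].
  have [|[]] := h L L.+1 (ltnSn L) L1; last by case: eqP; lia.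
  by have := ltn_ord (w (inord L.+1)); lia.
have mono w (i j : nat) : adapted false w s -> i <= j -> j <= m -> w (inord i) <= w (inord j).
  by move=> h le jm; apply: (adapted_mono h); rewrite !inordK; lia.
have desc k : P <= k -> k <= L -> f k.+1 < f k.
  move=> Pk kL; case: (eqVneq k P) => [->|nP]; first by case/andP: dP.
  case: (eqVneq k L) => [->|nL]; first by case/andP: dL.
  (* All positions from [P.+1] to [L] then have label 1 in [w0], so [s] decreases along them. *)
  have [w1 w2] := lab _ aw0.
  have m1 := @mono w0 P.+1 k aw0; have m2 := @mono w0 k k.+1 aw0.
  have m3 := @mono w0 k.+1 L aw0.
  have [|[]] := adE _ aw0 k k.+1 (ltnSn k) (leq_ltn_trans kL Lm); first lia.
  by case: eqP; lia.
have dec1 (i j : nat) : P <= i -> i < j -> j <= L.+1 -> f j < f i.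
  move=> Pi; elim: j => // j IH; rewrite ltnS => le_ij le.
  have fj : f j.+1 < f j by apply: desc; lia.
  by move: le_ij; rewrite leq_eqVlt => /orP[/eqP->//|/IH]; lia.
(* [c.1] puts [P] in the middle segment rather than the first, [c.2] puts [L.+1] in the last rather
   than the middle one. *)
pose lb (c : bool * bool) (i : nat) :=
  ((P < i) || (i == P) && c.1) + ((L.+1 < i) || (i == L.+1) && c.2).
have forced w (k : nat) : adapted false w s -> k <= m ->
    w (inord k) = lb (w (inord P) == 1 :> nat, w (inord L.+1) == 2 :> nat) k :> nat.
  move=> aw km; have [w1 w2] := lab _ aw; rewrite /lb /=.
  have lt3 i : w i < 3 := ltn_ord (w i).
  have PL1 := mono w P.+1 L.+1 aw PL Lm; have PL0 := mono w P L aw PL (ltnW Lm).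
  case: (ltngtP k P) => [kP|Pk|->] /=; last lia.
    have kP1 := mono w k P aw (ltnW kP) (dle _ dP).
    have := inc0 k P kP (leqnn _); have [|[]] := adE _ aw k P kP (dle _ dP); first lia.
    by case: eqP; lia.
  case: (ltngtP k L.+1) => [kL|Lk|->] /=; last by have := lt3 (inord L.+1); lia.
    by have m1 := mono w P.+1 k aw Pk km; have m2 := mono w k L aw kL (ltnW Lm); lia.
  have := inc2 L.+1 k (leqnn _) Lk km; have := lt3 (inord k).
  have [|[]] := adE _ aw L.+1 k Lk km; first lia.
  by case: eqP; lia.
pose gen c : {ffun 'I_m.+1 -> 'I_3} := [ffun i : 'I_m.+1 => inord (lb c i) : 'I_3].
have genE c i : gen c i = lb c i :> nat.
  by rewrite ffunE inordK // /lb; case: (_ || _); case: (_ || _).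
have gen_inj : injective gen.
  move=> [c1 c2] [d1 d2] /ffunP e.
  have e1 := congr1 val (e (inord P)); have e2 := congr1 val (e (inord L.+1)).
  move: e1 e2; rewrite /= !genE /lb !inordK /= ; try lia.
  move=> e1 e2; congr (_, _); lia.
have gen_ok c : adapted false (gen c) s.
  apply/adaptedP => i j lt_ij; have jm : j <= m := leq_ord j.
  have i0 := inc0 i j lt_ij; have i2 := inc2 i j; have d1 := dec1 i j.
  case: (ltnP (gen c i) (gen c j)) => [|le]; [by left | right].
  have ew : gen c i = gen c j by apply: val_inj; move: le; rewrite /= !genE /lb; lia.
  split=> //; move: (congr1 val ew); rewrite /neg addbF /= !genE !fE /lb => e.
  by case: eqP; lia.
rewrite (_ : [set w | _] = gen @: [set: bool * bool]); last first.
  apply/setP => w; rewrite inE; apply/idP/imsetP => [aw|[c _ ->]]; last exact: gen_ok.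
  exists (w (inord P) == 1 :> nat, w (inord L.+1) == 2 :> nat) => //.
  apply/ffunP => i; apply: val_inj; rewrite [RHS]genE -(forced _ _ aw (leq_ord i)).
  by rewrite inord_val.
by rewrite card_imset // cardsT card_prod card_bool.
Qed.

End Descents.
End Adapted.

(** * Cyclic permutations as conjugates of the rotation, and double counting *)

Section Cyclic.
Variable p : nat.
Local Notation Z := 'I_p.+3.
Implicit Types (s r : 'S_p.+3) (b : bool).

Definition rot1 : 'S_p.+3 := perm (@addIr Z 1%R).

Lemma rot1X k (x : Z) : (rot1 ^+ k)%g x = (x + k%:R)%R.
Proof.
elim: k x => [|k IH] x; first by rewrite perm1 addr0.
by rewrite expgS permM IH permE addrS.
Qed.

Lemma cyclic_permP s : reflect (exists r, s = (rot1 ^ r)%g) (cyclic_perm s).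
Proof.
apply: (iffP idP) => [/cards1P[C defC]|[r ->]].
  have orb x : porbit s x = C by apply/set1P; rewrite -defC imset_f.
  have full : porbit s 0%R = setT.
    by apply/setP => x; rewrite inE orb -(orb x) porbit_id.
  have ord0 : #|porbit s 0%R| = p.+3 by rewrite full cardsT card_ord.
  have inj : injective (fun k : Z => (s ^+ k)%g 0%R).
    have := uniq_traject_porbit s 0%R; rewrite ord0 => /(uniqP 0%R) u k l e.
    apply/val_inj/u; rewrite ?inE ?size_traject ?ltn_ord //.
    by rewrite !nth_traject ?ltn_ord // -!permX.
  (* The conjugator lists the cycle of [s] starting from 0. *)
  exists (perm inj); apply/permP => x.
  rewrite -[x](permKV (perm inj)) permJ; move: ((perm inj)^-1%g x) => k.
  have -> : perm inj (rot1 k) = (s ^+ (k.+1 %% p.+3))%g 0%R.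
    by rewrite !permE /= [1 %% _]modn_small // addn1.
  rewrite permE -permM -expgSr.
  have [lt|le] := ltnP k.+1 p.+3; first by rewrite modn_small.
  have -> : k.+1 = p.+3 by have := ltn_ord k; lia.
  by rewrite modnn expg0 perm1 permX; have := iter_porbit s 0%R; rewrite ord0.
apply/cards1P; exists setT; apply/setP => C; rewrite inE.
have full x : porbit (rot1 ^ r)%g x = setT.
  apply/setP => y; rewrite inE; apply/porbitP.
  exists ((r^-1)%g y - (r^-1)%g x : Z)%R.
  rewrite -conjXg -{2}(permKV r x) permJ rot1X natr_Zp addrC subrK.
  by rewrite permKV.
by apply/imsetP/eqP => [[x _ ->]|->]; [apply: full | exists 0%R; rewrite ?full].
Qed.

(** Since [rot1 ^ r] sends [r x] to [r (x + 1)], moving the letter at [x] to position [r x] turns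
    [good] into [adapted]. *)
Lemma card_good_adapted b r :
  #|[set a | good b a r]| = #|[set w | adapted b w (rot1 ^ r)%g]|.
Proof.
pose F (w : {ffun Z -> 'I_3}) := [ffun x => w (r x)].
have F_inj : injective F.
  by move=> w w' /ffunP e; apply/ffunP => x; have := e ((r^-1)%g x); rewrite !ffunE permKV.
rewrite -(card_imset [set w | adapted b w (rot1 ^ r)%g] F_inj); apply: eq_card => a.
have aE : F [ffun x => a ((r^-1)%g x)] = a by apply/ffunP => x; rewrite !ffunE permK.
rewrite -aE mem_imset // !inE; move: [ffun x => _] => w {aE}.
have nextE x : (rot1 ^ r)%g (r x) = r (x + 1)%R by rewrite permJ permE.
apply/forallP/forallP => h i; apply/forallP => j; apply/implyP.
  rewrite -[i](permKV r) -[j](permKV r); move: (r^-1%g i) (r^-1%g j) => x y lt.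
  by have := implyP (forallP (h x) y) lt; rewrite !ffunE !nextE.
by move=> lt; have := implyP (forallP (h (r i)) (r j)) lt; rewrite !ffunE !nextE.
Qed.

(** [card_adapted] excludes the identity, and after [adapted_rev] also the reversal; a cycle of
    length at least 3 is neither, as its square is not the identity. *)
Lemma card_adapted_cyclic b s : cyclic_perm s ->
  #|[set w | adapted b w s]| = 4 * in_sig_class [:: ~~ b; b; ~~ b] s.
Proof.
move=> /cyclic_permP[r es]; rewrite in_sig_classE; case: existsP => [[w aw]|nw]; last first.
  apply/eqP; rewrite muln0 cards_eq0; apply/eqP/setP => w; rewrite !inE.
  by apply/negbTE/negP => aw; case: nw; exists w.
have rot1_neq1 k : 0 < k < 3 -> (rot1 ^+ k)%g != 1%g.
  move=> hk; apply/eqP => /permP/(_ 0%R); rewrite rot1X perm1 add0r => /(congr1 val).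
  by rewrite Zp_nat /= modn_small; lia.
have conj_neq1 k : 0 < k < 3 -> (s ^+ k)%g != 1%g.
  move=> /rot1_neq1; rewrite es -conjXg; apply: contraNN => /eqP e.
  by rewrite -(inj_eq (conjg_inj r)) e conj1g.
case: b aw => aw; last by rewrite (card_adapted _ aw) // -[s]expg1 conj_neq1.
pose rv := perm (@rev_ord_inj p.+3).
have rv2 : (rv * rv = 1)%g by apply/permP => x; rewrite permM !permE rev_ordK.
rewrite (_ : [set w | _] = [set w | adapted false w (s * rv)%g]); last first.
  by apply/setP => w'; rewrite !inE adapted_rev.
rewrite adapted_rev in aw; rewrite (card_adapted _ aw) //.
apply: contraNneq (conj_neq1 2 isT) => e; have -> : s = rv.
  by rewrite -[LHS]mulg1 -rv2 mulgA e mul1g.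
by rewrite expgS expg1 rv2.
Qed.

(** Pairs of a word and a sorting permutation are counted in two ways: each [s] of the class is
    [rot1 ^ r] for [r] in a coset of the centralizer, and has four labellings. *)
Lemma sum_card_good_Csig b :
  \sum_a #|[set r : 'S_p.+3 | good b a r]| =
  #|Csig [:: ~~ b; b; ~~ b] p.+3| * (4 * #|'C[rot1]%g|).
Proof.
transitivity (\sum_(r : 'S_p.+3) #|[set a | good b a r]|).
  under eq_bigr do rewrite -sum1dep_card big_mkcond /=.
  rewrite exchange_big /=; apply: eq_bigr => r _.
  by rewrite -sum1dep_card [RHS]big_mkcond.
transitivity (\sum_(r : 'S_p.+3 | (rot1 ^ r)%g \in Csig [:: ~~ b; b; ~~ b] p.+3) 4).
  rewrite [RHS]big_mkcond; apply: eq_bigr => r _; rewrite card_good_adapted inE.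
  have cyc : cyclic_perm (rot1 ^ r)%g by apply/cyclic_permP; exists r.
  by rewrite card_adapted_cyclic // cyc; case: in_sig_class.
rewrite (partition_big (fun r => rot1 ^ r)%g (mem (Csig [:: ~~ b; b; ~~ b] p.+3))) //=.
rewrite -sum_nat_const; apply: eq_bigr => s sC.
have /cyclic_permP[r0 es] : cyclic_perm s by move: sC; rewrite inE => /andP[].
rewrite sum_nat_const mulnC -(card_rcoset _ r0); congr (_ * _); apply: eq_card => r.
rewrite [LHS]inE mem_rcoset cent1C.
transitivity (rot1 ^ r == s)%g; first by apply: andb_idl => /eqP ->.
rewrite es; apply/eqP/cent1P => [e|/commgP/conjg_fixP].
  by apply/commgP/conjg_fixP; rewrite conjgM e conjgK.
by rewrite conjgM => e; rewrite -[LHS](conjgKV r0) e.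
Qed.

End Cyclic.

Theorem theorem5p1 (n : nat) : 3 <= n ->
  #|Csig [:: true; false; true] n| = #|Csig [:: false; true; false] n|.
Proof.
case: n => [|[|[|p]]] // _.
have := sum_card_good_Csig p false; have := sum_card_good_Csig p true.
(* The primitive words contribute the same number for both signatures, so the sums agree and the
   common positive factor cancels. *)
rewrite !sum_card_good card_odd_doubled /= => -> /eqP.
rewrite eqn_pmul2r ?muln_gt0 ?cardG_gt0 // => /eqP e.
by rewrite e.
Qed.
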